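(* For every $\varepsilon>0$ there exist $c=c(\varepsilon)$ and $\eta=\eta(\varepsilon)\in(0,1]$ such that the following holds. Let $G$ be a graph with $n$ vertices and let $m$ be an integer with $cn\le m\le e(G)$. Then, with probability at least $1-\varepsilon$, the following statements (a) and (b) both hold: (a) the random graph $G_m$ satisfies $|q^*(G_m)-q^*(G)|<\varepsilon$; and (b) for every partition $\mathcal{A}$ of the vertex set, in a linear number of operations (seeing only $G_m$) the greedy amalgamating algorithm, run on $G_m$ with parameter $\eta$ and input partition $\mathcal{A}$, finds a partition $\mathcal{A}'$ with $q_{\mathcal{A}'}(G)\ge q_{\mathcal{A}}(G_m)-\varepsilon$.
   Context: Graphs are finite and simple; $e(G)$ is the number of edges of $G$. For a graph $G$ with $m\ge 1$ edges and a vertex partition $\mathcal{A}$, the modularity score is $q_{\mathcal{A}}(G)=\frac1m\sum_{A\in\mathcal{A}}e(A)-\frac1{4m^2}\sum_{A\in\mathcal{A}}\mathrm{vol}_G(A)^2$, where $e(A)$ is the number of edges of $G$ inside $A$ and $\mathrm{vol}_G(A)$ is the sum of the degrees in $G$ of the vertices in $A$; write $\mathrm{vol}(G)=2e(G)$. If $G$ has no edges, $q_{\mathcal{A}}(G)=0$. The modularity is $q^*(G)=\max_{\mathcal{A}}q_{\mathcal{A}}(G)$ over all vertex partitions. $G_m$ is the random graph on the vertex set of $G$ whose edge set is a uniformly random $m$-element subset of $E(G)$. Greedy bi-partitioning: given $y_1\ge\dots\ge y_r>0$ with $\sum_i y_i=1$, start with $A=B=\emptyset$; for $j=1,\dots,r$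 insert $j$ into $A$ if $\sum_{i\in A}y_i\le\sum_{i\in B}y_i$, and otherwise into $B$. Let $\gamma(y)$ be the minimum of the two final sums $\sum_{i\in A}y_i$, $\sum_{i\in B}y_i$. Greedy amalgamating algorithm: the input is a graph $H$ with at least one edge, $\eta\in(0,1]$ and a partition $\mathcal{B}=(B_1,\dots,B_n)$ of $V(H)$. Let $x_i=\mathrm{vol}_H(B_i)/\mathrm{vol}(H)$, with parts ordered so that $x_1\ge\dots\ge x_n$ (parts of volume 0 consist of isolated vertices, which are irrelevant to modularity scores in $H$; take them to be merged into an arbitrary other part, so that all $x_i>0$). Start with the trivial partition of $[n]$ into one part. While there is a part $I$ of the current partition of $[n]$ such that, with $S=\sum_{i\in I}x_i$ and $y=(x_i/S:i\in I)$, we have $\gamma(y)\ge\eta/S$, take the first such part $I$ and split it into the two sets produced by greedy bi-partitioning of $y$. If the final partition of $[n]$ is $(I_1,\dots,I_k)$, output the partition of $V(H)$ with parts $\bigcup_{i\in I_j}B_i$, $j=1,\dots,k$. ''Operations'' are arithmetic operations and comparisons of numbers; ''linear'' means linear in the number of parts of the input partition, for fixed $\eta$, given the ordered list of values $x_i$. *)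

(* Defs.v *)
From mathcomp Require Import all_boot all_order all_algebra.
From mathcomp Require Import boolp reals.

Set Implicit Arguments.
Unset Strict Implicit.
Unset Printing Implicit Defensive.

Import Order.TTheory GRing.Theory Num.Theory.

Local Open Scope ring_scope.

(* A graph on the vertex set [V] is given by its edge set, a set of
   two-element subsets of [V]; [#|E|] is its number of edges. *)

Definition simple_graph (V : finType) (E : {set {set V}}) : Prop :=
  forall e : {set V}, e \in E -> #|e| = 2.

Definition inner_edges (V : finType) (E : {set {set V}}) (A : {set V}) : nat :=
  #|[set e in E | e \subset A]|.

Definition degree (V : finType) (E : {set {set V}}) (v : V) : nat :=
  #|[set e in E | v \in e]|.

Definition vol (V : finType) (E : {set {set V}}) (A : {set V}) : nat :=
  (\sum_(v in A) degree E v)%N.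

Definition modularity_score (R : realFieldType) (V : finType)
    (E : {set {set V}}) (P : {set {set V}}) : R :=
  if #|E| == 0%N then 0 else
  (#|E|%:R)^-1 * (\sum_(A in P) (inner_edges E A)%:R)
  - (4 * #|E|%:R ^+ 2)^-1 * (\sum_(A in P) (vol E A)%:R ^+ 2).

(* The maximum is started from the score of the one-part partition, which is
   itself one of the partitions considered as soon as [V] is nonempty (and all
   the scores are 0 when [V] is empty). *)
Definition modularity (R : realFieldType) (V : finType) (E : {set {set V}}) : R :=
  \big[Num.max/modularity_score R E [set [set: V]]]_(P | partition P [set: V])
    modularity_score R E P.

Definition uniform_prob (R : realFieldType) (T : finType) (S : {set T})
    (P : T -> Prop) : R :=
  #|[set x in S | `[< P x >]]|%:R / #|S|%:R.

(* The possible values of the edge set of G_m, where E is the edge set of G. *)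
Definition edge_samples (V : finType) (E : {set {set V}}) (m : nat)
    : {set {set {set V}}} :=
  [set F : {set {set V}} | (F \subset E) && (#|F| == m)].

(* Computations paired with the number of operations they use. The algorithm
   below touches numbers only through [addc], [divc] and [lec], each of which
   counts for one operation. *)

Definition counted (T : Type) : Type := (nat * T)%type.

Definition ret (T : Type) (a : T) : counted T := (0%N, a).

Definition tick (T : Type) (a : T) : counted T := (1%N, a).

Definition bind (T U : Type) (p : counted T) (f : T -> counted U) : counted U :=
  ((p.1 + (f p.2).1)%N, (f p.2).2).

Notation "x <-- p ;; q" := (bind p (fun x => q))
  (at level 61, p at next level, right associativity).

Definition addc (R : realFieldType) (x y : R) : counted R := tick (x + y).
Definition divc (R : realFieldType) (x y : R) : counted R := tick (x / y).
Definition lec (R : realFieldType) (x y : R) : counted bool := tick (x <= y).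

Definition minc (R : realFieldType) (x y : R) : counted R :=
  b <-- lec x y ;; ret (if b then x else y).

Fixpoint sumc (R : realFieldType) (acc : R) (s : seq R) : counted R :=
  if s is x :: s' then acc' <-- addc acc x ;; sumc acc' s' else ret acc.

Fixpoint normalizec (R : realFieldType) (S : R) (s : seq R) : counted (seq R) :=
  if s is x :: s' then
    y <-- divc x S ;; ys <-- normalizec S s' ;; ret (y :: ys)
  else ret [::].

(* Greedy bi-partitioning of a list of pairs (j, y_j); [a] and [b] are the
   running sums of the y_j over the two sides [A] and [B]. *)
Fixpoint greedy_bipart (R : realFieldType) (A B : seq nat) (a b : R)
    (s : seq (nat * R)) : counted ((seq nat * R) * (seq nat * R)) :=
  if s is (j, y) :: s' then
    t <-- lec a b ;;
    if t then a' <-- addc a y ;; greedy_bipart (rcons A j) B a' b s'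
    else b' <-- addc b y ;; greedy_bipart A (rcons B j) a b' s'
  else ret ((A, a), (B, b)).

(* Indices are numbered from 0 and a part of the index set is an increasing
   list of indices, so that the values [nth 0 x i] along it are nonincreasing. *)
Definition try_split (R : realFieldType) (eta : R) (x : seq R) (J : seq nat)
    : counted (option (seq nat * seq nat)) :=
  S <-- sumc 0 [seq nth 0 x i | i <- J] ;;
  y <-- normalizec S [seq nth 0 x i | i <- J] ;;
  r <-- greedy_bipart [::] [::] 0 0 (zip J y) ;;
  gamma <-- minc r.1.2 r.2.2 ;;
  threshold <-- divc eta S ;;
  ok <-- lec threshold gamma ;;
  ret (if ok then Some (r.1.1, r.2.1) else None).

(* Splits the first part that has to be split; [None] if there is none. *)
Fixpoint split_first (R : realFieldType) (eta : R) (x : seq R)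
    (P : seq (seq nat)) : counted (option (seq (seq nat))) :=
  if P is J :: P' then
    r <-- try_split eta x J ;;
    if r is Some (A, B) then ret (Some (A :: B :: P'))
    else r' <-- split_first eta x P' ;; ret (omap (cons J) r')
  else ret None.

(* [amalgamation_loop eta x P k Q]: the while loop, started from the partition
   [P] of the index set, terminates with the partition [Q] after [k] operations. *)
Inductive amalgamation_loop (R : realFieldType) (eta : R) (x : seq R)
    : seq (seq nat) -> nat -> seq (seq nat) -> Prop :=
| Loop_stop (P : seq (seq nat)) (k : nat) :
    split_first eta x P = (k, None) -> amalgamation_loop eta x P k P
| Loop_step (P P' Q : seq (seq nat)) (k l : nat) :
    split_first eta x P = (k, Some P') ->
    amalgamation_loop eta x P' l Q ->
    amalgamation_loop eta x P (k + l) Q.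

Definition vol_ratios (R : realFieldType) (V : finType) (E : {set {set V}})
    (B : seq {set V}) : seq R :=
  [seq (vol E b)%:R / (2 * #|E|)%:R | b <- B].

(* The partition P in which each part b of volume 0 has been merged into the
   part [f b] of positive volume. *)
Definition merge_null_parts (V : finType) (E P : {set {set V}})
    (f : {set V} -> {set V}) : {set {set V}} :=
  [set a :|: \bigcup_(b in P | (vol E b == 0%N) && (f b == a)) b
     | a in P & (0 < vol E a)%N].

(* [B] is a list B_1, ..., B_n on which the algorithm may be run when its input
   graph is E and its input partition is P: the parts of volume 0 are merged
   into arbitrary other parts, and ties are ordered arbitrarily. *)
Definition amalgamation_input (R : realFieldType) (V : finType)
    (E P : {set {set V}}) (B : seq {set V}) : Prop :=
  [/\ (0 < #|E|)%N,
      sorted >=%R (vol_ratios R E B) &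
      exists f : {set V} -> {set V},
        (forall b : {set V}, b \in P -> vol E b = 0%N ->
           f b \in P /\ (0 < vol E (f b))%N)
        /\ perm_eq B (enum (merge_null_parts E P f))].

(* On the list [B], the algorithm terminates after [k] operations and outputs
   the partition [P']. *)
Definition greedy_amalgamation (R : realFieldType) (V : finType) (eta : R)
    (E : {set {set V}}) (B : seq {set V}) (k : nat) (P' : {set {set V}}) : Prop :=
  exists2 Q : seq (seq nat),
    amalgamation_loop eta (vol_ratios R E B) [:: iota 0 (size B)] k Q &
    P' = [set a in [seq \bigcup_(i <- J) nth set0 B i | J <- Q]].

(* Admissible lists always exist. *)
Lemma amalgamation_input_exists (R : realFieldType) (V : finType)
    (E P : {set {set V}}) :
  simple_graph E -> (0 < #|E|)%N -> partition P [set: V] ->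
  exists B : seq {set V}, amalgamation_input R E P B.
Proof.
move=> sE E0 partP.
have [e eE] := card_gt0P E0.
have /card_gt0P[v ve] : (0 < #|e|)%N by rewrite (sE _ eE).
have vP : v \in cover P by rewrite (cover_partition partP) inE.
have vol_gt0 : (0 < vol E (pblock P v))%N.
  rewrite /vol (bigD1 v) /= ?mem_pblock // ltn_addr //.
  by apply/card_gt0P; exists e; rewrite inE eE.
pose f := fun _ : {set V} => pblock P v.
pose r := relpre (fun b => (vol E b)%:R / (2 * #|E|)%:R : R) >=%R.
exists (sort r (enum (merge_null_parts E P f))); split=> //.
  rewrite sorted_map; apply: sort_sorted => a b.
  by rewrite /r /=; case: (leP ((vol E b)%:R / (2 * #|E|)%:R : R)) => //= /ltW.
exists f; split=> [b _ _|]; last by rewrite perm_sort.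
by split=> //; apply: pblock_mem.
Qed.

Lemma amalgamation_loop_functional (R : realFieldType) (eta : R) (x : seq R)
    (P : seq (seq nat)) (k k' : nat) (Q Q' : seq (seq nat)) :
  amalgamation_loop eta x P k Q -> amalgamation_loop eta x P k' Q' ->
  k = k' /\ Q = Q'.
Proof.
move=> run; elim: run k' Q' => {P k Q} [P k stop|P P1 Q k l step _ IH] k' Q' run'.
  by case: run' stop => [P0 k0 ->|P0 P1 Q0 k0 l0 -> _]; case.
case: run' step IH => [P0 k0 ->|P0 P2 Q0 k0 l0 -> run2] //.
by case=> -> eqP12 IH; rewrite eqP12 in run2; have [-> ->] := IH _ _ run2.
Qed.

(* Main.v *)
Require Import Defs.
From mathcomp Require Import all_boot all_order all_algebra.
From mathcomp Require Import boolp reals.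
From mathcomp Require Import sequences exp.
From mathcomp Require Import ring lra zify.

Import Order.TTheory GRing.Theory Num.Theory.

Local Open Scope ring_scope.

Set Implicit Arguments.
Unset Strict Implicit.
Unset Printing Implicit Defensive.

(** Two facts, both independent of the size of the graph, give the theorem.

    Few parts suffice.  Amalgamating with parameter [eta] leaves at most
    [1 / eta] parts and lowers the modularity score by at most [4 * eta]
    ([amalgamation_bound]).  A part is split only when both halves have relative
    volume at least [eta], so there are never more than [1 / eta] parts; this
    also bounds the number of rounds, each of which costs a linear number of
    operations.  Conversely, let [a] and [b] be the two greedy sums of a part
    [J] that is not split.  Inserting each value on the lighter side keeps
    [(a - b)^2] at most the sum of the squares of the values inserted so far
    ([greedy_bipart_gap]).  Hence merging [J] raises the degree tax by at most
    [(a + b)^2 - (a - b)^2 = 4 a b], which is at most [4 * eta] times the weight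
    of [J] since the smaller side is below [eta]; and merging never loses an
    inner edge.  Summed over the parts, whose weights add up to 1, this is
    [4 * eta].

    Scores of partitions with few parts survive sampling.  The volume of a set
    [A] is [e(G) + e(A) - e(V \ A)], so a score is determined by the densities
    [e(A) / e(G)] ([vol_ratio_density]), and it moves by at most [3 d] per part
    when each density moves by at most [d] ([modularity_score_close]).  For one
    set [A], the number of sampled edges inside [A] is hypergeometric, and a
    deviation of [d] has probability at most [2 exp (- d^2 m / 8)]
    ([hypergeometric_upper_tail], for the edges inside [A] and for the other
    ones).  There are [2^n] sets [A], so all densities are [d]-close with high
    probability as soon as [m / n] is large ([edge_close_prob]).

    On that event, (b) follows by amalgamating in [G_m] and transferring the
    score of the coarse partition to [G]; (a) follows by applying this to an
    arbitrary partition of [G_m], and symmetrically by amalgamating in [G] and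
    transferring to [G_m]. *)

(** * The greedy amalgamating algorithm *)

Section Algorithm.
Variable R : realFieldType.
Implicit Types (eta : R) (x : seq R) (w : nat -> R).
Implicit Types (J : seq nat) (P Q : seq (seq nat)).

Lemma sumcE (acc : R) (s : seq R) : sumc acc s = (size s, acc + \sum_(y <- s) y).
Proof.
elim: s acc => [|y s IH] acc /=; first by rewrite big_nil addr0.
by rewrite /bind /= IH big_cons addrA.
Qed.

Lemma normalizecE (S : R) (s : seq R) :
  normalizec S s = (size s, [seq y / S | y <- s]).
Proof. by elim: s => [|y s IH] //=; rewrite /bind /= IH /= addn0. Qed.

Lemma zip_mapr (w : nat -> R) J : zip J (map w J) = [seq (j, w j) | j <- J].
Proof. by elim: J => //= j J ->. Qed.

Lemma greedy_bipart_cost A B (a b : R) s :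
  (greedy_bipart A B a b s).1 = (2 * size s)%N.
Proof.
elim: s A B a b => [|[j y] s IH] A B a b //=.
by rewrite /bind /=; case: (a <= b); rewrite /= IH; lia.
Qed.

(** The running sums carried by the algorithm are the sums of [w] over the two
    sides, so that statements about sums are statements about parts. *)
Lemma greedy_bipart_sides w A B (a b : R) J :
    a = \sum_(j <- A) w j -> b = \sum_(j <- B) w j ->
  let r := (greedy_bipart A B a b [seq (j, w j) | j <- J]).2 in
  [/\ perm_eq (r.1.1 ++ r.2.1) (A ++ B ++ J),
      r.1.2 = \sum_(j <- r.1.1) w j & r.2.2 = \sum_(j <- r.2.1) w j].
Proof.
elim: J A B a b => [|j J IH] A B a b aE bE /=; first by rewrite cats0.
rewrite /bind /=; case: (a <= b) => /=.
- have [||pe -> ->] := IH (rcons A j) B (a + w j) b => //.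
    by rewrite -cats1 big_cat big_seq1 /= aE.
  split=> //; apply: perm_trans pe _.
  rewrite -cats1 -catA perm_cat2l.
  by rewrite catA (perm_catAC [:: j] B J) perm_sym -cat1s perm_catCA catA perm_catAC.
- have [||pe -> ->] := IH A (rcons B j) a (b + w j) => //.
    by rewrite -cats1 big_cat big_seq1 /= bE.
  by split=> //; rewrite -cats1 -catA in pe *.
Qed.

(** Inserting [y] on the lighter side changes the difference [a - b] towards the
    opposite sign, so its square grows by at most [y^2]. *)
Lemma greedy_bipart_gap w A B (a b : R) J : (forall j, 0 <= w j) ->
  let r := (greedy_bipart A B a b [seq (j, w j) | j <- J]).2 in
  (r.1.2 - r.2.2) ^+ 2 <= (a - b) ^+ 2 + \sum_(j <- J) w j ^+ 2.
Proof.
move=> w0; elim: J A B a b => [|j J IH] A B a b /=.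
  by rewrite big_nil addr0.
rewrite /bind /= big_cons; have wj := w0 j; case: (leP a b) => /= ab.
- apply: le_trans (IH _ _ _ _) _.
  rewrite addrA lerD2r; nra.
- apply: le_trans (IH _ _ _ _) _.
  rewrite addrA lerD2r; nra.
Qed.

Definition weight x J := \sum_(i <- J) nth 0 x i.

(** The left-hand side is the increase of the degree tax when the blocks indexed
    by [J] are merged; the right-hand side is linear in the weight, hence can be summed
    over the parts. *)
Definition cheap_to_merge eta x J :=
  weight x J ^+ 2 - \sum_(i <- J) nth 0 x i ^+ 2 <= 4 * eta * weight x J.

Lemma try_split_cost eta x J : (try_split eta x J).1 = (4 * size J + 3)%N.
Proof.
rewrite /try_split sumcE /bind /= normalizecE /= greedy_bipart_cost.
by rewrite size_map size_zip !size_map minnn; lia.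
Qed.

(** With [a] and [b] the normalised sides, [a + b = 1], and [greedy_bipart_gap]
    bounds the sum of squares below by [(a - b)^2 = 1 - 4 a b].  When the split is
    refused, [a b <= min a b < eta / S]. *)
Lemma try_splitP eta x J : (forall i, 0 <= nth 0 x i) -> 0 < weight x J ->
  match (try_split eta x J).2 with
  | Some (A, B) =>
      [/\ perm_eq (A ++ B) J, eta <= weight x A & eta <= weight x B]
  | None => cheap_to_merge eta x J
  end.
Proof.
move=> x0 S0; rewrite /try_split sumcE add0r big_map -/(weight x J) /bind /=.
rewrite normalizecE /= -map_comp /comp zip_mapr.
set S := weight x J in S0 *.
pose w i := nth 0 x i / S.
have w0 i : 0 <= w i by rewrite divr_ge0 // ltW.
have wE K : \sum_(i <- K) w i = weight x K / S by rewrite mulr_suml.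
have := @greedy_bipart_gap w [::] [::] 0 0 J w0.
have := @greedy_bipart_sides w [::] [::] 0 0 J.
rewrite !big_nil => /(_ erefl erefl) /=.
case: (greedy_bipart _ _ _ _ _) => k [[A a] [B b]] /= [pAB aE bE].
rewrite subrr expr0n add0r.
have abE : a + b = 1.
  by rewrite aE bE -big_cat (perm_big _ pAB) wE divff ?gt_eqF.
have a0 : 0 <= a by rewrite aE sumr_ge0.
have b0 : 0 <= b by rewrite bE sumr_ge0.
have -> : \sum_(j <- J) w j ^+ 2 = (\sum_(j <- J) nth 0 x j ^+ 2) / S ^+ 2.
  by rewrite mulr_suml; apply: eq_bigr => i _; rewrite expr_div_n.
rewrite ler_pdivlMr ?exprn_gt0 // => gap.
rewrite ler_pdivrMr //.
case: ifP => ok.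
- split=> //; rewrite -(@ler_pM2r _ (S^-1)) ?invr_gt0 // -wE -?aE -?bE.
    rewrite ler_pdivrMr //; apply: le_trans ok _; rewrite ler_pM2r //.
    by case: (leP a b) => // /ltW.
  rewrite ler_pdivrMr //; apply: le_trans ok _; rewrite ler_pM2r //.
  by case: (leP a b).
- move/negbT: ok; rewrite -ltNge => lt_eta; rewrite /cheap_to_merge -/S.
  have ab_min : a * b <= if a <= b then a else b.
    by case: (leP a b) => ab; nra.
  have : a * b * S <= eta.
    by apply: le_trans (ltW lt_eta); rewrite ler_pM2r.
  have -> : b = 1 - a by lra.
  rewrite (_ : b = 1 - a) in gap; last by lra.
  by nra.
Qed.

(** One step of the recursion, with [try_split] kept folded. *)
Lemma split_first_cons eta x J P :
  split_first eta x (J :: P) = bind (try_split eta x J) (fun r =>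
    if r is Some (A, B) then ret (Some (A :: B :: P))
    else bind (split_first eta x P) (fun r' => ret (omap (cons J) r'))).
Proof. by []. Qed.

Definition heavy eta x J := eta <= weight x J.

Lemma split_first_cost eta x P :
  ((split_first eta x P).1 <= 4 * size (flatten P) + 3 * size P)%N.
Proof.
elim: P => [|J P IH] //; rewrite split_first_cons [flatten _]/= size_cat.
have := try_split_cost eta x J; case: (try_split eta x J) => [c [[A B]|]] /= cE.
  by lia.
by move: IH; case: (split_first eta x P) => k o /=; lia.
Qed.

Lemma split_firstP eta x P : (forall i, 0 <= nth 0 x i) -> 0 < eta ->
    all (heavy eta x) P ->
  match (split_first eta x P).2 with
  | Some P' => [/\ size P' = (size P).+1, perm_eq (flatten P') (flatten P)
                 & all (heavy eta x) P']
  | None => forall J, J \in P -> cheap_to_merge eta x J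
  end.
Proof.
move=> x0 eta0; elim: P => [|J P IH] // /andP[hJ hP]; rewrite split_first_cons.
have := @try_splitP eta x J x0 (lt_le_trans eta0 hJ).
case: (try_split eta x J) => [c [[A B]|]] /= => [[pAB hA hB]|uJ].
  by split=> //; [rewrite catA perm_cat2r | apply/and3P].
move: (IH hP); case: (split_first eta x P) => [k [P'|]] /=.
  by case=> -> pe ->; rewrite hJ perm_cat2l.
by move=> uP K; rewrite inE => /predU1P[->|/uP].
Qed.

(** This bounds the number of parts by [1 / eta] at every stage of the loop. *)
Lemma heavy_size eta x P : all (heavy eta x) P ->
  (size P)%:R * eta <= weight x (flatten P).
Proof.
elim: P => [|J P IH] /=; first by rewrite mul0r /weight big_nil.
move=> /andP[hJ /IH hP]; rewrite /weight big_cat /= -natr1 mulrDl mul1r addrC.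
exact: lerD.
Qed.

Lemma heavy_size_flatten eta x P : 0 < eta -> all (heavy eta x) P ->
  (size P <= size (flatten P))%N.
Proof.
move=> eta0; elim: P => [|J P IH] //= /andP[hJ /IH hP]; rewrite size_cat.
case: J hJ => [|j J] hJ /=; last by lia.
by move: hJ; rewrite /heavy /weight big_nil leNgt eta0.
Qed.

(** The number of parts grows by one in each round and never exceeds [K], so
    [K.+1 - size P] rounds remain; as there are also at most [N] parts, a round
    costs at most [4 N + 3 N] operations. *)
Lemma amalgamation_loop_terminates eta x (K N : nat) :
    (forall i, 0 <= nth 0 x i) -> 0 < eta ->
    weight x (iota 0 N) = 1 -> 1 <= K%:R * eta ->
  forall P, perm_eq (flatten P) (iota 0 N) -> all (heavy eta x) P ->
  exists (k : nat) Q,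
    [/\ amalgamation_loop eta x P k Q, (k <= 7 * N * (K.+1 - size P))%N,
        perm_eq (flatten Q) (iota 0 N), all (heavy eta x) Q &
        forall J, J \in Q -> cheap_to_merge eta x J].
Proof.
move=> x0 eta0 x1 Keta P; have [d dE] : exists d, d = (K.+1 - size P)%N by eexists.
have sizeK P' : perm_eq (flatten P') (iota 0 N) -> all (heavy eta x) P' ->
    (size P' <= K)%N /\ (size P' <= N)%N.
  move=> pP' hP'; split; last first.
    by have := heavy_size_flatten eta0 hP'; rewrite (perm_size pP') size_iota.
  rewrite -(ler_nat R) -(ler_pM2r eta0); apply: le_trans Keta.
  by have := heavy_size hP'; rewrite /weight (perm_big _ pP') -/(weight _ _) x1.
elim: d P dE => [|d IH] P dE pP hP; have [PK PN] := sizeK P pP hP.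
  by move: dE PK; lia.
have costP := split_first_cost eta x P.
rewrite (perm_size pP) size_iota in costP.
have := @split_firstP eta x P x0 eta0 hP.
case spE: (split_first eta x P) costP => [k [P'|]] /= costP; last first.
  move=> uP; exists k, P; split=> //; first exact: Loop_stop.
  by rewrite -dE; nia.
case=> sP' pP' hP'.
have [||l [Q [run lN pQ hQ uQ]]] := IH P' _ _ hP'.
- by rewrite sP'; lia.
- exact: perm_trans pP' pP.
exists (k + l)%N, Q; split=> //; first exact: Loop_step spE run.
have dE' : d = (K.+1 - size P')%N by rewrite sP'; lia.
by rewrite -dE mulnS; rewrite -dE' in lN; lia.
Qed.

End Algorithm.

(** * Volumes and inner edges *)

Section Volume.
Variable V : finType.
Implicit Types (E P : {set {set V}}) (A B : {set V}).

(** An edge meets [A] in 0, 1 or 2 vertices, and is inside the complement of [A]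
    in the first case only, inside [A] in the last case only. *)
Lemma vol_inner_edges E A : simple_graph E ->
  (vol E A + inner_edges E (~: A) = #|E| + inner_edges E A)%N.
Proof.
move=> sE; have -> : vol E A = (\sum_(e in E) #|e :&: A|)%N.
  rewrite /vol /degree; under eq_bigr do rewrite -sum1dep_card big_mkcondr /=.
  rewrite exchange_big /=; apply: eq_bigr => e _.
  rewrite -sum1_card -big_mkcondr /=; apply: eq_bigl => v.
  by rewrite inE andbC.
have innerE X : inner_edges E X = (\sum_(e in E) (e \subset X))%N.
  rewrite /inner_edges -sum1dep_card big_mkcondr /=.
  by apply: eq_bigr => e _; case: (e \subset X).
rewrite !innerE -sum1_card -!big_split /=; apply: eq_bigr => e /sE e2.
have eA : (e \subset A) = (2 <= #|e :&: A|)%N.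
  by rewrite (sameP setIidPl eqP) eqEcard subsetIl e2.
have eCA : (e \subset ~: A) = (#|e :&: A| == 0)%N.
  by rewrite -disjoints_subset -setI_eq0 cards_eq0.
have : (#|e :&: A| <= 2)%N.
  by rewrite -[leqRHS]e2; apply/subset_leq_card/subsetIl.
by rewrite eA eCA; case: #|_| => [|[|[|]]].
Qed.

Lemma inner_edges_set0 E : simple_graph E -> inner_edges E set0 = 0%N.
Proof.
move=> sE; apply/eqP; rewrite cards_eq0 -subset0; apply/subsetP => e.
by rewrite !inE subset0 => /andP[/sE e2 /eqP e0]; rewrite e0 cards0 in e2.
Qed.

Lemma inner_edges_le E A : (inner_edges E A <= #|E|)%N.
Proof. by apply: subset_leq_card; apply/subsetP => e; rewrite inE => /andP[]. Qed.

Lemma inner_edgesS E A B : A \subset B -> (inner_edges E A <= inner_edges E B)%N.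
Proof.
move=> AB; apply: subset_leq_card; apply/subsetP => e.
by rewrite !inE => /andP[-> /subset_trans ->].
Qed.

Lemma inner_edges_le_vol E A : simple_graph E -> (inner_edges E A <= vol E A)%N.
Proof.
by move=> sE; have := vol_inner_edges A sE; have := inner_edges_le E (~: A); lia.
Qed.

Lemma vol_setT E : simple_graph E -> vol E [set: V] = (2 * #|E|)%N.
Proof.
move=> sE; have := vol_inner_edges [set: V] sE.
rewrite setCT inner_edges_set0 // addn0 => ->; rewrite mul2n -addnn; congr addn.
by apply: eq_card => e; rewrite inE subsetT andbT.
Qed.

Lemma sum_vol_partition E P : simple_graph E -> partition P [set: V] ->
  (\sum_(A in P) vol E A = 2 * #|E|)%N.
Proof. by move=> sE pP; rewrite -vol_setT // /vol (set_partition_big _ pP). Qed.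

Lemma vol_setU E A B : (vol E (A :|: B) <= vol E A + vol E B)%N.
Proof.
rewrite /vol (bigID (mem A)) /= leq_add //.
  rewrite (eq_bigl (mem A)) // => v.
  by rewrite !inE; case: (v \in A); rewrite ?andbF.
rewrite [leqRHS](bigID (mem A)) /= (eq_bigl (fun v => (v \in B) && (v \notin A))).
  exact: leq_addl.
by move=> v; rewrite inE; case: (v \in A); rewrite ?andbF ?andbT.
Qed.

Lemma vol_bigcup E (I : Type) (r : seq I) (p : pred I) (D : I -> {set V}) :
  (vol E (\bigcup_(i <- r | p i) D i) <= \sum_(i <- r | p i) vol E (D i))%N.
Proof.
elim/big_rec2: _ => [|i n A _ le_n]; first by rewrite /vol big_set0.
by apply: leq_trans (vol_setU _ _ _) _; rewrite leq_add2l.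
Qed.

(** No edge is counted twice, since an edge inside two disjoint sets would be
    empty. *)
Lemma inner_edges_bigcup E (I : eqType) (r : seq I) (D : I -> {set V}) :
    simple_graph E -> uniq r ->
    {in r &, forall i j, i != j -> [disjoint D i & D j]} ->
  (\sum_(i <- r) inner_edges E (D i) <= inner_edges E (\bigcup_(i <- r) D i))%N.
Proof.
move=> sE; elim: r => [|i r IH]; first by rewrite !big_nil.
move=> /andP[ir ur] dD; rewrite !big_cons.
have {}IH := IH ur (sub_in2 (fun j jr => mem_behead jr) dD).
apply: leq_trans (leq_add (leqnn _) IH) _.
set U := \bigcup_(j <- r) D j.
have dU : [disjoint D i & U].
  rewrite /U big_seq; elim/big_rec: _ => [|j X jr dX].
    by rewrite -setI_eq0 setI0.
  rewrite -setI_eq0 setIUr (disjoint_setI0 dX) setU0 setI_eq0.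
  apply: dD; rewrite ?mem_head ?inE ?jr ?orbT //.
  by apply: contraNneq ir => ->.
have edge_once : [set e in E | e \subset D i] :&: [set e in E | e \subset U] = set0.
  apply/setP => e; rewrite !inE; apply/negP => /andP[/andP[eE eD] /andP[_ eU]].
  have : e \subset D i :&: U by rewrite subsetI eD.
  rewrite (disjoint_setI0 dU) subset0 => /eqP e0.
  by have := sE e eE; rewrite e0 cards0.
rewrite /inner_edges -cardsUI edge_once cards0 addn0.
apply: subset_leq_card; apply/subsetP => e; rewrite !inE.
by case/orP=> /andP[-> /subset_trans->] //; [exact: subsetUl | exact: subsetUr].
Qed.

(** Both partitions built below are images of a list of labels; the second
    conclusion turns sums over the parts into sums over the labels. *)
Lemma partition_of_family (I : eqType) (L : seq I) (D : I -> {set V}) :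
    uniq L -> (forall v, exists2 a, a \in L & v \in D a) ->
    {in L &, forall a b v, v \in D a -> v \in D b -> a = b} ->
    {in L, forall a, exists v, v \in D a} ->
  partition [set X in [seq D a | a <- L]] [set: V] /\
  perm_eq (enum [set X in [seq D a | a <- L]]) [seq D a | a <- L].
Proof.
move=> uL covL disL neL; split; last first.
  apply: uniq_perm; first exact: enum_uniq.
    rewrite map_inj_in_uniq // => a b aL bL eqD.
    by have [v va] := neL a aL; apply: (disL a b aL bL v); rewrite -?eqD.
  by move=> X; rewrite mem_enum inE.
apply/and3P; split.
- rewrite -subTset; apply/subsetP => v _; have [a aL va] := covL v.
  by apply/bigcupP; exists (D a) => //; rewrite inE map_f.
- apply/trivIsetP => X Y; rewrite !inE => /mapP[a aL ->] /mapP[b bL ->].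
  apply: contraR => /pred0Pn[v /andP[/= va vb]].
  by rewrite (disL a b aL bL v).
- by rewrite inE; apply/mapP => -[a /neL[v va] D0]; rewrite -D0 inE in va.
Qed.

End Volume.

(** * Merging parts *)

Section Score.
Variables (R : realFieldType) (V : finType).
Implicit Types (E P : {set {set V}}) (A : {set V}).

Definition vol_ratio E A : R := (vol E A)%:R / (2 * #|E|)%:R.

Definition part_score E A : R :=
  (inner_edges E A)%:R / #|E|%:R - vol_ratio E A ^+ 2.

Lemma modularity_score_sum E P : (0 < #|E|)%N ->
  modularity_score R E P = \sum_(A in P) part_score E A.
Proof.
move=> E0; rewrite /modularity_score gtn_eqF // !mulr_sumr -sumrB.
apply: eq_bigr => A _; rewrite /part_score /vol_ratio natrM; field.
by rewrite pnatr_eq0 -lt0n.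
Qed.

Lemma vol_ratio_ge0 E A : 0 <= vol_ratio E A.
Proof. by rewrite divr_ge0. Qed.

Lemma sum_vol_ratio E P : simple_graph E -> (0 < #|E|)%N ->
  partition P [set: V] -> \sum_(A in P) vol_ratio E A = 1.
Proof.
move=> sE E0 pP; rewrite -mulr_suml -natr_sum sum_vol_partition //.
by rewrite divff // pnatr_eq0; lia.
Qed.

(** Null parts contribute nothing to the score and add no volume to the part
    that absorbs them. *)
Lemma merge_null_partsP E P (f : {set V} -> {set V}) :
    simple_graph E -> partition P [set: V] ->
    (forall b, b \in P -> vol E b = 0%N -> f b \in P /\ (0 < vol E (f b))%N) ->
  [/\ partition (merge_null_parts E P f) [set: V],
      (#|merge_null_parts E P f| <= #|P|)%N &
      \sum_(A in P) part_score E A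
        <= \sum_(A in merge_null_parts E P f) part_score E A].
Proof.
move=> sE pP fP.
pose g a := a :|: \bigcup_(b in P | (vol E b == 0%N) && (f b == a)) b.
pose L := enum [set a in P | (0 < vol E a)%N].
have inL a : (a \in L) = (a \in P) && (0 < vol E a)%N by rewrite mem_enum inE.
have mE : merge_null_parts E P f = [set X in [seq g a | a <- L]].
  apply/setP => X; rewrite inE; apply/imsetP/mapP => -[a aL ->]; exists a => //.
    by rewrite inL; move: aL; rewrite inE.
  by rewrite inE -inL.
have block v b : b \in P -> v \in b -> pblock P v = b.
  by move=> bP vb; apply: def_pblock => //; case/and3P: pP.
(* The label of the part of the merged partition that contains [v]. *)
pose h v := let b := pblock P v in if vol E b == 0%N then f b else b.
have gh a v : a \in L -> v \in g a -> h v = a.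
  rewrite inL => /andP[aP a0]; rewrite inE => /orP[va|/bigcupP[b]].
    by rewrite /h (block v a) // gtn_eqF.
  by move=> /andP[bP /andP[b0 /eqP fb]] vb; rewrite /h (block v b) // b0.
have [||||pm pe] := @partition_of_family V _ L g.
- exact: enum_uniq.
- move=> v; have vP : v \in cover P by rewrite (cover_partition pP) inE.
  have bP : pblock P v \in P by rewrite pblock_mem.
  have vb : v \in pblock P v by rewrite mem_pblock.
  case b0 : (vol E (pblock P v) == 0%N).
    have [fP1 fP2] := fP _ bP (eqP b0).
    exists (f (pblock P v)); first by rewrite inL fP1.
    rewrite inE; apply/orP; right; apply/bigcupP; exists (pblock P v) => //.
    by rewrite bP b0 eqxx.
  by exists (pblock P v); [rewrite inL bP lt0n b0 | rewrite inE vb].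
- by move=> a b aL bL v /(gh _ _ aL) <- /(gh _ _ bL) <-.
- move=> a; rewrite inL => /andP[aP _].
  have /set0Pn[v va] : a != set0.
    by apply: contraTneq aP => ->; case/and3P: pP.
  by exists v; rewrite inE va.
rewrite mE; split=> //.
  rewrite cardE (perm_size pe) size_map -cardE.
  by apply: subset_leq_card; apply/subsetP => a; rewrite inE => /andP[].
rewrite -[leRHS]big_enum (perm_big _ pe) big_map /= big_enum /=.
rewrite (bigID (fun a => 0 < vol E a)%N) /= addrC big1 ?add0r.
  rewrite [leRHS](eq_bigl (fun a => (a \in P) && (0 < vol E a)%N)); last first.
    by move=> a; rewrite inE.
  apply: ler_sum => a /andP[aP a0]; rewrite /part_score lerB //.
    by rewrite ler_wpM2r ?invr_ge0 ?ler0n // ler_nat inner_edgesS // subsetUl.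
  have volg : (vol E (g a) <= vol E a)%N.
    apply: leq_trans (vol_setU _ _ _) _; rewrite -[leqRHS]addn0 leq_add2l.
    apply: leq_trans (vol_bigcup _ _ _ _) _; rewrite leqn0 big1 // => b.
    by case/and3P=> _ /eqP.
  rewrite ler_sqr ?nnegrE ?vol_ratio_ge0 //.
  by rewrite ler_wpM2r ?invr_ge0 ?ler0n // ler_nat.
move=> a /andP[aP]; rewrite -eqn0Ngt => /eqP a0; rewrite /part_score /vol_ratio a0.
have := inner_edges_le_vol a sE; rewrite a0 leqn0 => /eqP ->.
by rewrite !mul0r expr0n subrr.
Qed.

End Score.

Lemma uniq_flatten_inj (T : eqType) (Q : seq (seq T)) (J K : seq T) (i : T) :
  uniq (flatten Q) -> J \in Q -> K \in Q -> i \in J -> i \in K -> J = K.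
Proof.
elim: Q => [|L Q IH] //=; rewrite cat_uniq => /and3P[_ /hasPn dLQ uQ].
have notin M : M \in Q -> i \in M -> i \notin L.
  by move=> MQ iM; apply: dLQ; apply/flattenP; exists M.
rewrite !inE => /predU1P[->|JQ] /predU1P[->|KQ] // iJ iK.
- by have := notin K KQ iK; rewrite iJ.
- by have := notin J JQ iJ; rewrite iK.
- exact: IH.
Qed.

Lemma uniq_flatten_parts (T : eqType) (Q : seq (seq T)) :
  uniq (flatten Q) -> [::] \notin Q -> uniq Q /\ {in Q, forall J, uniq J}.
Proof.
elim: Q => [|L Q IH] //=; rewrite cat_uniq inE negb_or.
move=> /and3P[uL /hasPn dLQ uQ] /andP[L0 Q0]; have [-> uJ] := IH uQ Q0.
rewrite andbT; split; last by move=> J; rewrite inE => /predU1P[->|/uJ].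
apply/negP => LQ; case: L L0 LQ dLQ uL => // i L _ LQ dLQ _.
have iQ : i \in flatten Q by apply/flattenP; exists (i :: L); rewrite ?mem_head.
by have := dLQ i iQ; rewrite /= mem_head.
Qed.

Section Blocks.
Variables (R : realFieldType) (V : finType).
Implicit Types (E P : {set {set V}}) (B : seq {set V}).

Definition block_union B (J : seq nat) := \bigcup_(i <- J) nth set0 B i.

Lemma mem_block_union B J v :
  reflect (exists2 i, i \in J & v \in nth set0 B i) (v \in block_union B J).
Proof.
rewrite /block_union; elim: J => [|j J IH].
  by rewrite big_nil inE; constructor => -[].
rewrite big_cons inE; apply: (iffP orP) => [[vj|/IH[i iJ vi]]|[i]].
- by exists j; rewrite ?mem_head.
- by exists i => //; rewrite inE iJ orbT.
- by rewrite inE => /predU1P[->|iJ] vi; [left | right; apply/IH; exists i].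
Qed.

(** The weights of the parts add up to 1, so the bounds of [cheap_to_merge]
    add up to [4 * eta]. *)
Lemma union_blocksP (eta : R) E P B (Q : seq (seq nat)) :
    simple_graph E -> (0 < #|E|)%N ->
    partition P [set: V] -> perm_eq B (enum P) ->
    perm_eq (flatten Q) (iota 0 (size B)) -> [::] \notin Q ->
    {in Q, forall J, cheap_to_merge eta (vol_ratios R E B) J} ->
  let P' := [set X in [seq block_union B J | J <- Q]] in
  [/\ partition P' [set: V], #|P'| = size Q &
      \sum_(A in P) part_score R E A - 4 * eta
        <= \sum_(A in P') part_score R E A].
Proof.
move=> sE E0 pP pB pQ Q0 cheap P'.
have uB : uniq B by rewrite (perm_uniq pB) enum_uniq.
have memB X : (X \in B) = (X \in P) by rewrite (perm_mem pB) mem_enum.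
have uF : uniq (flatten Q) by rewrite (perm_uniq pQ) iota_uniq.
have [uQ uJ] := uniq_flatten_parts uF Q0.
have sizeB J i : J \in Q -> i \in J -> (i < size B)%N.
  move=> JQ iJ; have : i \in flatten Q by apply/flattenP; exists J.
  by rewrite (perm_mem pQ) mem_iota.
have triv i j v : (i < size B)%N -> (j < size B)%N ->
    v \in nth set0 B i -> v \in nth set0 B j -> i = j.
  move=> iB jB vi vj; apply/eqP; rewrite -(nth_uniq set0 iB jB uB).
  have tP : trivIset P by case/and3P: pP.
  rewrite -(def_pblock tP _ vi) -?memB ?mem_nth //.
  by rewrite (def_pblock tP _ vj) // -memB mem_nth.
have [||||pP' pe] := @partition_of_family V _ Q (block_union B).
- exact: uQ.
- move=> v; have vP : v \in cover P by rewrite (cover_partition pP) inE.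
  have bB : pblock P v \in B by rewrite memB pblock_mem.
  have : index (pblock P v) B \in flatten Q.
    by rewrite (perm_mem pQ) mem_iota /= index_mem.
  case/flattenP => J JQ iJ; exists J => //; apply/mem_block_union.
  by exists (index (pblock P v) B); rewrite ?nth_index // mem_pblock.
- move=> J K JQ KQ v /mem_block_union[i iJ vi] /mem_block_union[j jK vj].
  have eq_ij := triv i j v (sizeB _ _ JQ iJ) (sizeB _ _ KQ jK) vi vj.
  by apply: (uniq_flatten_inj uF JQ KQ iJ); rewrite eq_ij.
- move=> J JQ; case: J JQ => [|i J] JQ; first by rewrite JQ in Q0.
  have : nth set0 B i \in P by rewrite -memB mem_nth // (sizeB _ _ JQ) ?mem_head.
  move=> iP; have /set0Pn[v vi] : nth set0 B i != set0.
    by apply: contraTneq iP => ->; case/and3P: pP.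
  by exists v; apply/mem_block_union; exists i; rewrite ?mem_head.
have sumB (F : {set V} -> R) :
    \sum_(A in P) F A = \sum_(J <- Q) \sum_(i <- J) F (nth set0 B i).
  rewrite -big_enum -(perm_big _ pB) /= (big_nth set0) /index_iota subn0.
  by rewrite -(perm_big _ pQ) big_flatten.
split=> //; first by rewrite cardE (perm_size pe) size_map.
have nthx i : (i < size B)%N ->
    nth 0 (vol_ratios R E B) i = vol_ratio R E (nth set0 B i).
  by move=> iB; rewrite (nth_map set0).
rewrite -[leRHS]big_enum (perm_big _ pe) big_map /= sumB.
have -> : 4 * eta = \sum_(J <- Q) 4 * eta * weight (vol_ratios R E B) J.
  rewrite -mulr_sumr -[LHS]mulr1; congr (_ * _).
  rewrite -(sum_vol_ratio R sE E0 pP) sumB big_seq [RHS]big_seq.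
  apply: eq_bigr => J JQ; rewrite /weight big_seq [RHS]big_seq.
  by apply: eq_bigr => i iJ; rewrite nthx // (sizeB J).
rewrite -sumrB big_seq [leRHS]big_seq; apply: ler_sum => J JQ.
have weightE : weight (vol_ratios R E B) J
    = \sum_(i <- J) vol_ratio R E (nth set0 B i).
  rewrite /weight big_seq [RHS]big_seq; apply: eq_bigr => i iJ.
  by rewrite nthx // (sizeB J).
have sqE : \sum_(i <- J) nth 0 (vol_ratios R E B) i ^+ 2
    = \sum_(i <- J) vol_ratio R E (nth set0 B i) ^+ 2.
  rewrite big_seq [RHS]big_seq; apply: eq_bigr => i iJ.
  by rewrite nthx // (sizeB J).
have edges : \sum_(i <- J) (inner_edges E (nth set0 B i))%:R / #|E|%:R
    <= (inner_edges E (block_union B J))%:R / #|E|%:R :> R.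
  rewrite -mulr_suml ler_wpM2r ?invr_ge0 ?ler0n // -natr_sum ler_nat.
  apply: inner_edges_bigcup => // [|i j iJ jJ]; first exact: uJ.
  apply: contraR => /pred0Pn[v /andP[/= vi vj]]; apply/eqP.
  exact: triv (sizeB _ _ JQ iJ) (sizeB _ _ JQ jJ) vi vj.
have tax : vol_ratio R E (block_union B J) ^+ 2
    <= weight (vol_ratios R E B) J ^+ 2.
  rewrite weightE ler_sqr ?nnegrE ?vol_ratio_ge0 ?sumr_ge0 // => [|i _];
    last exact: vol_ratio_ge0.
  rewrite /vol_ratio -mulr_suml ler_wpM2r ?invr_ge0 ?ler0n //.
  by rewrite -natr_sum ler_nat vol_bigcup.
have := cheap J JQ; rewrite /cheap_to_merge sqE.
rewrite /part_score sumrB; lra.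
Qed.

(** The heaviness of all parts, true initially because the single part has
    weight 1, is what bounds their final number by [K]. *)
Lemma amalgamation_bound (eta : R) (K : nat) E P B :
    simple_graph E -> 0 < eta -> eta <= 1 -> 1 <= K%:R * eta ->
    partition P [set: V] -> amalgamation_input R E P B ->
  exists (k : nat) (P' : {set {set V}}),
    [/\ greedy_amalgamation eta E B k P', (k <= 7 * K.+1 * #|P|)%N,
        partition P' [set: V], (#|P'| <= K)%N &
        modularity_score R E P - 4 * eta <= modularity_score R E P'].
Proof.
move=> sE eta0 eta1 Keta pP [E0 _ [f [fP pB]]].
have [pM cM scM] := merge_null_partsP R sE pP fP.
set M := merge_null_parts E P f in pB pM cM scM.
pose x := vol_ratios R E B.
have x0 i : 0 <= nth 0 x i.
  have [iB|Bi] := ltnP i (size B); last by rewrite nth_default // size_map.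
  by rewrite (nth_map set0) // divr_ge0.
have x1 : weight x (iota 0 (size B)) = 1.
  rewrite -(sum_vol_ratio R sE E0 pM) -big_enum -(perm_big _ pB) /= /weight.
  rewrite (big_nth set0) /index_iota subn0 big_seq [RHS]big_seq.
  by apply: eq_bigr => i; rewrite mem_iota => /= iB; rewrite (nth_map set0).
have := @amalgamation_loop_terminates R eta x K (size B) x0 eta0 x1 Keta.
case/(_ [:: iota 0 (size B)]).
- by rewrite /= cats0.
- by rewrite /= /heavy x1 eta1.
move=> k [Q [run kN pQ hQ uQ]].
have Q0 : [::] \notin Q.
  by apply/negP => /(allP hQ); rewrite /heavy /weight big_nil leNgt eta0.
have [pP' cP' scP'] := union_blocksP sE E0 pM pB pQ Q0 uQ.
have sizeB : size B = #|M| by rewrite (perm_size pB) -cardE.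
exists k, [set X in [seq block_union B J | J <- Q]]; split=> //.
- by exists Q.
- apply: leq_trans kN _; rewrite sizeB -!mulnA leq_mul2l /= mulnC.
  by rewrite leq_mul // leq_subr.
- rewrite cP' -(ler_nat R) -(ler_pM2r eta0); apply: le_trans Keta.
  by have := heavy_size hQ; rewrite /weight (perm_big _ pQ) -/(weight x _) x1.
- rewrite !modularity_score_sum //; apply: le_trans scP'.
  by rewrite lerB.
Qed.

End Blocks.

(** * Tails of the hypergeometric distribution *)

Section Hypergeometric.
Variable T : finType.
Implicit Types (E S F J : {set T}).

Definition subsets_of_size E m := [set F : {set T} | (F \subset E) && (#|F| == m)].

(** Removing [J] is a bijection onto the subsets of [E :\: J] of size
    [m - #|J|]. *)
Lemma card_supersets E J m : J \subset E -> (#|J| <= m)%N ->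
  #|[set F in subsets_of_size E m | J \subset F]| = 'C(#|E| - #|J|, m - #|J|).
Proof.
move=> JE Jm; rewrite -cardsDS // -cards_draws.
have -> : [set F in subsets_of_size E m | J \subset F] =
    [set J :|: K | K in [set K : {set T} |
      (K \subset E :\: J) & (#|K| == m - #|J|)%N]].
  apply/setP=> F; apply/idP/imsetP.
  - rewrite !inE => /andP[/andP[FE /eqP Fm] JF].
    exists (F :\: J); last by rewrite -{1}(setID F J) (setIidPr JF).
    by rewrite inE setSD //= cardsDS // Fm.
  - case=> K; rewrite inE subsetD => /andP[/andP[KE dKJ] /eqP Km] ->.
    rewrite !inE subUset JE KE subsetUl /= andbT.
    by rewrite cardsU disjoint_setI0 1?disjoint_sym // cards0 Km subn0 subnKC.
rewrite card_in_imset // => K L; rewrite !inE !subsetD.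
move=> /andP[/andP[_ dK] _] /andP[/andP[_ dL] _] eqJ.
have := congr1 (fun X => X :\: J) eqJ; rewrite /= !setDUl setDv !set0U.
by rewrite (setDidPl dK) (setDidPl dL).
Qed.

(** Both sides count the pairs of a [j]-subset of [S] and an [m]-subset of [E]
    that contains it: these are the binomial moments of the hypergeometric
    distribution. *)
Lemma sum_bin_subsets E S m j : S \subset E -> (j <= m)%N ->
  (\sum_(F in subsets_of_size E m) 'C(#|F :&: S|, j) =
   'C(#|S|, j) * 'C(#|E| - j, m - j))%N.
Proof.
move=> SE jm.
under eq_bigr do rewrite -cards_draws -sum1_card.
rewrite (exchange_big_dep (mem (subsets_of_size S j))) /=; last first.
  move=> F J _; rewrite !inE => /andP[+ ->]; rewrite andbT.
  by move/subset_trans; apply; apply: subsetIr.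
rewrite -cards_draws -sum_nat_const; apply: eq_bigr => J.
rewrite !inE => /andP[JS /eqP Jj].
rewrite -Jj -card_supersets ?Jj //; last exact: subset_trans JS SE.
rewrite sum1_card; apply: eq_card => F.
by rewrite unfold_in /= !inE subsetI JS Jj eqxx !andbT.
Qed.

(** Multiplied by [j`!] this compares falling factorials, where factor by factor
    [(s - i) / (M - i) <= s / M]. *)
Lemma bin_scale (s M j : nat) : (s <= M)%N ->
  ('C(s, j) * M ^ j <= 'C(M, j) * s ^ j)%N.
Proof.
move=> sM; rewrite -(@leq_pmul2r j`!) ?fact_gt0 //.
rewrite mulnAC bin_ffact [leqRHS]mulnAC bin_ffact.
elim: j => [|j IH] //; rewrite !ffactnSr !expnSr.
have -> : (s ^_ j * (s - j) * (M ^ j * M) = s ^_ j * M ^ j * ((s - j) * M))%N by ring.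
have -> : (M ^_ j * (M - j) * (s ^ j * s) = M ^_ j * s ^ j * ((M - j) * s))%N by ring.
apply: leq_mul => //; rewrite !mulnBl mulnC leq_sub2l // leq_mul2l sM orbT.
by [].
Qed.

Variable R : realType.

Lemma expr1D_bin (u : R) (k m : nat) : (k <= m)%N ->
  (1 + u) ^+ k = \sum_(j < m.+1) 'C(k, j)%:R * u ^+ j.
Proof.
move=> km; rewrite exprDn.
transitivity (\sum_(j < k.+1) ('C(k, j)%:R * u ^+ j : R)).
  by apply: eq_bigr => j _; rewrite expr1n mul1r mulr_natl.
rewrite (big_ord_widen m.+1 (fun j => 'C(k, j)%:R * u ^+ j : R)) //.
rewrite big_mkcond; apply: eq_bigr => j _ /=; case: ltnP => // kj.
by rewrite bin_small // mul0r.
Qed.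

(** The right-hand side is the moment generating function of a binomial variable
    (sampling with replacement).  Expanding both sides in powers of [u], the
    coefficients are binomial moments, which [bin_scale] compares one by one. *)
Lemma hypergeometric_mgf E S m (u : R) : S \subset E -> 0 <= u ->
  \sum_(F in subsets_of_size E m) (1 + u) ^+ #|F :&: S|
    <= 'C(#|E|, m)%:R * (1 + u * (#|S|%:R / #|E|%:R)) ^+ m.
Proof.
move=> SE u0; set s := #|S|; set M := #|E|.
have sM : (s <= M)%N by apply: subset_leq_card.
have E_binom (X : {set T}) : X \subset E -> forall j : 'I_m.+1,
    \sum_(F in subsets_of_size E m) 'C(#|F :&: X|, j)%:R
    = ('C(#|X|, j) * 'C(M - j, m - j))%:R :> R.
  by move=> XE j; rewrite -natr_sum sum_bin_subsets // -ltnS.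
rewrite (expr1D_bin _ (leqnn m)) mulr_sumr.
under eq_bigr => F FE.
  rewrite (@expr1D_bin _ _ m); last first.
    move: FE; rewrite inE => /andP[_ /eqP <-].
    by rewrite subset_leq_card // subsetIl.
  over.
rewrite exchange_big /=; apply: ler_sum => j _; rewrite -mulr_suml E_binom //.
(* The case [S = E] of the same double counting. *)
have binE : ('C(M, m) * 'C(m, j) = 'C(M, j) * 'C(M - j, m - j))%N.
  have jm : (j <= m)%N by rewrite -ltnS.
  rewrite -(sum_bin_subsets (subxx E) jm) -[in LHS]cards_draws -sum_nat_const.
  apply: eq_bigr => F; rewrite inE => /andP[FE /eqP Fm].
  by rewrite (setIidPl FE) Fm.
rewrite mulrA -natrM binE !natrM exprMn mulrA [leRHS]mulrAC.
rewrite ler_wpM2r ?exprn_ge0 // mulrAC ler_wpM2r ?ler0n //.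
have [M0|M_gt0] := posnP M.
  have s0 : s = 0%N by apply/eqP; rewrite -leqn0 -M0.
  rewrite -/s s0 M0 mul0r; case: (nat_of_ord j) => [|i].
    by rewrite !bin0 expr0 mulr1.
  by rewrite !bin0n mul0r.
rewrite expr_div_n mulrA ler_pdivlMr ?exprn_gt0 ?ltr0n //.
by rewrite -!natrX -!natrM ler_nat bin_scale.
Qed.

Lemma expR_le_quadratic (l : R) : 0 <= l <= 2^-1 -> expR l <= 1 + l + 2 * l ^+ 2.
Proof.
move=> /andP[l0 l1].
have e1 := expR_ge1Dx (- l); have e2 : expR l * expR (- l) = 1.
  by rewrite -expRD subrr expR0.
have e0 := expR_gt0 l.
have l2 : 0 <= l ^+ 2 * (1 - 2 * l) by rewrite mulr_ge0 ?sqr_ge0 //; lra.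
rewrite -(@ler_pM2r _ (1 - l)); last by lra.
have : expR l * (1 - l) <= 1 by rewrite -[leRHS]e2 ler_pM2l.
by move/le_trans; apply; lra.
Qed.

(** Markov's inequality for [expR (l * X)], where [l = d / 4] makes the exponent
    [2 l^2 - l d] minimal; this is [- d^2 / 8]. *)
Lemma hypergeometric_upper_tail E S m (d : R) :
    S \subset E -> 0 < d -> d <= 2 ->
  #|[set F in subsets_of_size E m |
      (#|S|%:R / #|E|%:R + d) * m%:R <= #|F :&: S|%:R]|%:R
    <= 'C(#|E|, m)%:R * expR (- (d ^+ 2 / 8 * m%:R)).
Proof.
move=> SE d0 d2; set p : R := _ / _; set B := [set F in _ | _].
have p0 : 0 <= p by rewrite divr_ge0.
have p1 : p <= 1.
  rewrite /p; have [->|M0] := posnP #|E|; first by rewrite invr0 mulr0.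
  by rewrite ler_pdivrMr ?ltr0n // mul1r ler_nat subset_leq_card.
pose l := d / 4; pose u := expR l - 1.
have uE : 1 + u = expR l by rewrite /u addrC subrK.
have u0 : 0 <= u by have := expR_ge1Dx l; rewrite /u /l; lra.
have ul : u <= l + 2 * l ^+ 2.
  by have := @expR_le_quadratic l; rewrite /u /l; lra.
have mgf := hypergeometric_mgf m SE u0; rewrite -/p in mgf.
(* Samples outside [B] contribute nonnegative terms. *)
have markov : #|B|%:R * expR (l * ((p + d) * m%:R))
    <= \sum_(F in subsets_of_size E m) (1 + u) ^+ #|F :&: S|.
  rewrite [leRHS](bigID (mem B)) /=.
  rewrite -[leLHS]addr0 lerD //; last first.
    by apply: sumr_ge0 => F _; rewrite exprn_ge0 // addr_ge0.
  rewrite mulr_natl -sumr_const.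
  apply: le_trans (_ : \sum_(F in B) (1 + u) ^+ #|F :&: S| <= _).
    apply: ler_sum => F; rewrite inE => /andP[_ XF].
    rewrite uE -expRM_natl ler_expR mulrC ler_wpM2r //.
    by rewrite /l; lra.
  rewrite [leLHS](eq_bigl (fun F => (F \in subsets_of_size E m) && (F \in B))) //.
  by move=> F; rewrite !inE; case: (F \subset E); case: (#|F| == m).
have up : (1 + u * p) ^+ m <= expR (- (d ^+ 2 / 8 * m%:R) + l * ((p + d) * m%:R)).
  have : 1 + u * p <= expR (u * p) := expR_ge1Dx _.
  move/(@lerXn2r _ m _ _) => /(_ _ _)/le_trans; apply.
  - by rewrite nnegrE addr_ge0 // mulr_ge0.
  - by rewrite nnegrE ltW // expR_gt0.
  rewrite -expRM_natl ler_expR.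
  have -> : - (d ^+ 2 / 8 * m%:R) + l * ((p + d) * m%:R)
      = m%:R * (l * (p + d) - d ^+ 2 / 8) by ring.
  rewrite ler_wpM2l //.
  have : u * p <= (l + 2 * l ^+ 2) * p by rewrite ler_wpM2r.
  have : 2 * l ^+ 2 * p <= 2 * l ^+ 2.
    by rewrite -[leRHS]mulr1 ler_wpM2l // mulr_ge0 ?sqr_ge0.
  rewrite /l; nra.
rewrite -(@ler_pM2r _ (expR (l * ((p + d) * m%:R)))) ?expR_gt0 //.
apply: le_trans markov _; apply: le_trans mgf _.
by rewrite -[leRHS]mulrA -expRD ler_wpM2l.
Qed.

End Hypergeometric.

(** * From a graph to a random subgraph *)

Section Transfer.
Variables (R : realFieldType) (V : finType).
Implicit Types (E F P : {set {set V}}) (A : {set V}).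

Definition density E A : R := (inner_edges E A)%:R / #|E|%:R.

Definition edge_close (d : R) E F :=
  [forall A : {set V}, `|density F A - density E A| <= d].

Lemma density_itv E A : 0 <= density E A <= 1.
Proof.
rewrite /density divr_ge0 //=.
have [->|E0] := posnP #|E|; first by rewrite invr0 mulr0.
by rewrite ler_pdivrMr ?ltr0n // mul1r ler_nat inner_edges_le.
Qed.

(** Densities alone determine scores, so only inner edge counts, and no degrees,
    have to be controlled in a random subgraph. *)
Lemma vol_ratio_density E A : simple_graph E -> (0 < #|E|)%N ->
  vol_ratio R E A = (1 + density E A - density E (~: A)) / 2.
Proof.
move=> sE E0; have := vol_inner_edges A sE.
move/(congr1 (fun n => n%:R : R)); rewrite !natrD => volE.
have M0 : #|E|%:R != 0 :> R by rewrite pnatr_eq0 -lt0n.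
have {}volE : (vol E A)%:R
    = #|E|%:R + (inner_edges E A)%:R - (inner_edges E (~: A))%:R :> R by lra.
by rewrite /vol_ratio /density natrM volE; field.
Qed.

(** On each part the density moves by at most [d], and the squared volume ratio
    by at most [2 d] because the ratio itself moves by at most [d] and lies in
    [0, 1]. *)
Lemma modularity_score_close (d : R) (K : nat) E F P :
    simple_graph E -> (0 < #|E|)%N -> simple_graph F -> (0 < #|F|)%N ->
    0 <= d -> edge_close d E F -> (#|P| <= K)%N ->
  `|modularity_score R F P - modularity_score R E P| <= 3 * d * K%:R.
Proof.
move=> sE E0 sF F0 d0 /forallP dEF PK.
rewrite !modularity_score_sum // -sumrB.
apply: le_trans (_ : 3 * d * #|P|%:R <= _); last first.
  by rewrite ler_wpM2l ?mulr_ge0 // ler_nat.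
rewrite mulr_natr -sumr_const; apply: le_trans (ler_norm_sum _ _ _) _.
apply: ler_sum => A _; rewrite /part_score -/(density F A) -/(density E A).
rewrite !vol_ratio_density //.
have := density_itv E A; have := density_itv F A.
have := density_itv E (~: A); have := density_itv F (~: A).
have := dEF A; have := dEF (~: A); rewrite !ler_norml.
move: (density E A) (density F A) (density E (~: A)) (density F (~: A)).
move=> x y x' y' /andP[? ?] /andP[? ?] /andP[? ?] /andP[? ?] /andP[? ?] /andP[? ?].
pose a := (1 + y - y') / 2; pose b := (1 + x - x') / 2.
have /andP[? ?] : 0 <= a + b <= 2 by apply/andP; rewrite /a /b; split; lra.
have /andP[? ?] : - d <= a - b <= d by apply/andP; rewrite /a /b; split; lra.
rewrite -/a -/b.
(* [a] and [b] are the two volume ratios. *)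
have -> : y - a ^+ 2 - (x - b ^+ 2) = (y - x) - (a - b) * (a + b) by ring.
by apply/andP; split; nra.
Qed.

End Transfer.

Section Sampling.
Variables (R : realType) (V : finType).
Implicit Types (E F : {set {set V}}) (A : {set V}).

(** Union bound over the [2^n] sets [A].  A density that is too small is a too
    large number of sampled edges that are not inside [A], so upper tails
    suffice. *)
Lemma edge_close_prob E (m : nat) (d : R) : (0 < m <= #|E|)%N ->
    0 < d -> d <= 2 ->
  #|[set F in edge_samples E m | ~~ edge_close d E F]|%:R
    <= 2 ^+ #|V| * (2 * ('C(#|E|, m)%:R * expR (- (d ^+ 2 / 8 * m%:R)))).
Proof.
move=> /andP[m0 mE] d0 d2; have E0 : (0 < #|E|)%N := leq_trans m0 mE.
pose inner A := [set e in E | e \subset A].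
pose over (S : {set {set V}}) := [set F in subsets_of_size E m |
      (#|S|%:R / #|E|%:R + d) * m%:R <= #|F :&: S|%:R].
have innerE A : inner A \subset E by apply/subsetP => e; rewrite inE => /andP[].
have cover_bad : [set F in edge_samples E m | ~~ edge_close d E F]
    \subset \bigcup_(A : {set V}) (over (inner A) :|: over (E :\: inner A)).
  apply/subsetP => F; rewrite inE => /andP[FE].
  rewrite negb_forall => /existsP[A]; rewrite -ltNge => far.
  apply/bigcupP; exists A => //; rewrite !in_setU !(inE, FE) /=.
  move: FE; rewrite inE => /andP[FE /eqP Fm].
  have FA : (inner_edges F A = #|F :&: inner A|)%N.
    rewrite /inner_edges; apply: eq_card => e; rewrite !inE.
    by case eF : (e \in F) => //=; rewrite (subsetP FE _ eF).
  have FI : (#|F :&: inner A| + #|F :&: (E :\: inner A)| = m)%N.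
    by rewrite setIDA (setIidPl FE) cardsID.
  have EI : (#|inner A| + #|E :\: inner A| = #|E|)%N.
    by rewrite -(cardsID (inner A) E) (setIidPr (innerE A)).
  move: far; rewrite /density FA Fm -/(inner A).
  rewrite (_ : inner_edges E A = #|inner A|) //.
  move/(congr1 (fun n => n%:R : R)): FI; rewrite natrD => FI.
  move/(congr1 (fun n => n%:R : R)): EI; rewrite natrD => EI.
  have M_gt0 : 0 < #|E|%:R :> R by rewrite ltr0n.
  have m_gt0 : 0 < m%:R :> R by rewrite ltr0n.
  have -> : #|E :\: inner A|%:R / #|E|%:R = 1 - #|inner A|%:R / #|E|%:R :> R.
    rewrite (_ : #|E :\: inner A|%:R = #|E|%:R - #|inner A|%:R :> R); last by lra.
    by rewrite mulrBl divff // gt_eqF.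
  have -> : #|F :&: (E :\: inner A)|%:R = m%:R - #|F :&: inner A|%:R :> R by lra.
  set X := #|F :&: inner A|%:R; set p := #|inner A|%:R / _.
  rewrite FE eqxx /= lter_normr => /orP[far|far]; apply/orP; [left|right].
    by rewrite -ler_pdivlMr //; lra.
  have : X / m%:R <= p - d by lra.
  rewrite ler_pdivrMr //; lra.
have card_cover : (#|[set F in edge_samples E m | ~~ edge_close d E F]|
    <= \sum_(A : {set V}) (#|over (inner A)| + #|over (E :\: inner A)|))%N.
  apply: leq_trans (subset_leq_card cover_bad) _.
  elim/big_rec2: _ => [|A n U _ le_n]; first by rewrite cards0.
  apply: leq_trans (leq_card_setU _ _) _; apply: leq_add => //.
  exact: leq_card_setU.
move: card_cover; rewrite -(ler_nat R) => /le_trans; apply; rewrite natr_sum.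
have -> : 2 ^+ #|V| = #|{set V}|%:R :> R.
  rewrite -natrX; congr _%:R.
  by rewrite -[RHS]cardsT -powersetT card_powerset cardsT.
rewrite mulr_natl -sumr_const; apply: ler_sum => A _.
rewrite natrD mulr_natl mulr2n lerD //; apply: hypergeometric_upper_tail => //.
exact: subsetDl.
Qed.

Lemma uniform_prob_ge (T : finType) (S : {set T}) (p : T -> Prop)
    (b : pred T) (eps : R) :
    (0 < #|S|)%N -> {in S, forall x, b x -> p x} ->
    #|[set x in S | ~~ b x]|%:R <= eps * #|S|%:R ->
  1 - eps <= uniform_prob R S p.
Proof.
move=> S0 bp bad; rewrite /uniform_prob ler_pdivlMr ?ltr0n //.
have : (#|S| <= #|[set x in S | `[< p x >]]| + #|[set x in S | ~~ b x]|)%N.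
  rewrite addnC -leq_subLR -cardsDS; last first.
    by apply/subsetP => x; rewrite inE => /andP[].
  apply: subset_leq_card; apply/subsetP => x; rewrite !inE.
  case/andP=> /nandP h xS; rewrite xS /=; apply/asboolP; apply: bp => //.
  by case: h; rewrite ?xS ?negbK.
rewrite -(ler_nat R) natrD; lra.
Qed.

End Sampling.

Theorem corollary1p4 (R : realType) (eps : R) (heps : 0 < eps) :
  exists (c eta : R) (C : nat),
    [/\ 0 < c, 0 < eta, eta <= 1 &
    forall (V : finType) (E : {set {set V}}) (m : nat),
      simple_graph E ->
      c * #|V|%:R <= m%:R ->
      (m <= #|E|)%N ->
      1 - eps <= uniform_prob R (edge_samples E m) (fun F : {set {set V}} =>
        `|modularity R F - modularity R E| < eps
        /\
        forall (A : {set {set V}}) (B : seq {set V}),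
          partition A [set: V] ->
          amalgamation_input R F A B ->
          exists (k : nat) (A' : {set {set V}}),
            [/\ greedy_amalgamation eta F B k A',
                (k <= C * #|A|)%N,
                partition A' [set: V] &
                modularity_score R F A - eps <= modularity_score R E A'])].
Proof.
pose e : R := Num.min eps 1.
have e0 : 0 < e by rewrite lt_min heps ltr01.
have e1 : e <= 1 by rewrite ge_min lexx orbT.
have e_eps : e <= eps by rewrite ge_min lexx.
(* Of the budget [e], amalgamating costs [4 * eta = e / 4] and passing from one
   graph to the other costs [3 * d * K = e / 4]. *)
pose eta := e / 16.
have eta0 : 0 < eta by rewrite divr_gt0.
have [K K1] : exists K : nat, 1 <= K%:R * eta.
  exists (Num.truncn eta^-1).+1; rewrite -ler_pdivrMr // mul1r.
  exact/ltW/truncnS_gt.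
have K0 : 0 < K%:R :> R by rewrite -(pmulr_lgt0 _ eta0); lra.
pose d := e / (12 * K%:R).
have d0 : 0 < d by rewrite divr_gt0 // mulr_gt0.
have dK : 3 * d * K%:R = e / 4 by rewrite /d; field; rewrite gt_eqF.
have d2 : d <= 2.
  have K1' : 1 <= K%:R :> R by move: K0; rewrite ltr0n ler1n.
  by rewrite /d ler_pdivrMr ?mulr_gt0 //; nra.
(* With this [c], [d^2 / 8 * m >= (4 / e) * n], which makes the failure
   probability at most [2^n * 2 * q^n <= (4 q)^n <= e] for [q = exp (- 4 / e)]. *)
pose c := 32 / (d ^+ 2 * e).
have dd0 : 0 < d ^+ 2 * e by rewrite mulr_gt0 ?exprn_gt0.
have c0 : 0 < c by rewrite divr_gt0.
exists c, eta, (7 * K.+1)%N; split=> //; first by rewrite /eta; lra.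
move=> V E m sE cm mE.
have card_samples : #|edge_samples E m| = 'C(#|E|, m) by apply: cards_draws.
have samples0 : (0 < #|edge_samples E m|)%N by rewrite card_samples bin_gt0.
have simpleF F : F \in edge_samples E m -> simple_graph F /\ #|F| = m.
  rewrite inE => /andP[FE /eqP Fm]; split=> // f fF.
  by apply: sE; apply: (subsetP FE).
(* If [m = 0] then [V] is empty, because [c > 0]; both graphs have no edges. *)
have [m0|m_gt0] := posnP m.
  have V0 : #|V| = 0%N.
    by apply/eqP; move: cm; rewrite m0 pmulr_rle0 // lern0.
  have E0 : E = set0.
    apply/setP => f; rewrite inE; apply/negP => /sE f2.
    by have := max_card (mem f); rewrite f2 V0.
  apply: (@uniform_prob_ge _ _ _ _ predT) => // [F FS _|]; last first.
    rewrite (_ : [set _ in _ | _] = set0) ?cards0 ?mulr_ge0 // ?ltW //.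
    by apply/setP => x; rewrite !inE andbF.
  have F0 : F = set0 by apply/cards0_eq; rewrite (simpleF F FS).2.
  rewrite F0 E0 subrr normr0; split=> // A B _ [].
  by rewrite cards0.
have E_gt0 : (0 < #|E|)%N := leq_trans m_gt0 mE.
have V_gt0 : (0 < #|V|)%N.
  have /card_gt0P[f fE] := E_gt0; have := max_card (mem f).
  by rewrite (sE f fE); apply: leq_trans.
have part1 : partition [set [set: V]] [set: V].
  apply/and3P; split; [by rewrite /cover big_set1 | exact: trivIset1 |].
  by rewrite inE eq_sym -card_gt0 cardsT.
have modularity_ge F P : partition P [set: V] ->
    modularity_score R F P <= modularity R F.
  by move=> pP; apply: le_bigmax_cond.
have modularity_le F x : (forall P, partition P [set: V] ->
    modularity_score R F P <= x) -> modularity R F <= x.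
  by move=> h; apply/bigmax_leP; split=> [|P /h//]; apply: h.
apply: (@uniform_prob_ge _ _ _ _ (edge_close d E)) => // [F FS cEF|].
- have [sF Fm] := simpleF F FS; have F_gt0 : (0 < #|F|)%N by rewrite Fm.
  have close (P : {set {set V}}) : (#|P| <= K)%N ->
      `|modularity_score R F P - modularity_score R E P| <= e / 4.
    by rewrite -dK; apply: modularity_score_close => //; apply: ltW.
  have coarsen (G P : {set {set V}}) (B : seq {set V}) :
      simple_graph G -> partition P [set: V] -> amalgamation_input R G P B ->
    exists (k : nat) (P' : {set {set V}}),
    [/\ greedy_amalgamation eta G B k P', (k <= 7 * K.+1 * #|P|)%N,
        partition P' [set: V], (#|P'| <= K)%N &
        modularity_score R G P - e / 4 <= modularity_score R G P'].
    move=> sG pP inP.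
    have -> : e / 4 = 4 * eta by rewrite /eta; field.
    by apply: amalgamation_bound => //; rewrite /eta; lra.
  have part_b (A : {set {set V}}) (B : seq {set V}) :
      partition A [set: V] -> amalgamation_input R F A B ->
    exists (k : nat) (A' : {set {set V}}),
      [/\ greedy_amalgamation eta F B k A', (k <= 7 * K.+1 * #|A|)%N,
          partition A' [set: V] &
          modularity_score R F A - e / 2 <= modularity_score R E A'].
    move=> pA inA; have [k [A' [run kA pA' cA' scA']]] := coarsen F A B sF pA inA.
    exists k, A'; split=> //.
    by have := close A' cA'; rewrite ler_norml => /andP[]; lra.
  split; last first.
    move=> A B pA inA; have [k [A' [run kA pA' scA']]] := part_b A B pA inA.
    by exists k, A'; split=> //; lra.
  apply: le_lt_trans (_ : e / 2 < eps); last by lra.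
  have le1 : modularity R F <= modularity R E + e / 2.
    apply: modularity_le => A pA.
    have [B inA] := amalgamation_input_exists R sF F_gt0 pA.
    have [k [A' [_ _ pA' scA']]] := part_b A B pA inA.
    by have := modularity_ge E A' pA'; lra.
  have le2 : modularity R E <= modularity R F + e / 2.
    apply: modularity_le => A pA.
    have [B inA] := amalgamation_input_exists R sE E_gt0 pA.
    have [k [A' [_ _ pA' cA' scA']]] := coarsen E A B sE pA inA.
    have := modularity_ge F A' pA'; have := close A' cA'.
    by rewrite ler_norml => /andP[]; lra.
  by rewrite ler_norml; apply/andP; split; lra.
- apply: le_trans (edge_close_prob _ d0 d2) _; first by rewrite m_gt0.
  rewrite card_samples.
  have rate : 4 / e * #|V|%:R <= d ^+ 2 / 8 * m%:R.
    have -> : 4 / e = d ^+ 2 / 8 * c by rewrite /c; field; rewrite !gt_eqF.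
    by rewrite -[leLHS]mulrA ler_wpM2l // divr_ge0 // sqr_ge0.
  pose q := expR (- (4 / e)).
  have q0 : 0 < q by apply: expR_gt0.
  have q4 : 4 * q <= e.
    have qV : q * expR (4 / e) = 1 by rewrite -expRD addNr expR0.
    have : q * (4 / e) <= q * expR (4 / e).
      by rewrite ler_pM2l //; have := expR_ge1Dx (4 / e); lra.
    by rewrite qV mulrA ler_pdivrMr // mul1r mulrC.
  have tail : expR (- (d ^+ 2 / 8 * m%:R)) <= q ^+ #|V|.
    by rewrite -expRM_natl ler_expR mulrN lerN2 mulrC.
  have powers : 2 ^+ #|V| * 2 * q ^+ #|V| <= e.
    have le4q : 2 ^+ #|V| * 2 * q ^+ #|V| <= (4 * q) ^+ #|V|.
      rewrite (_ : 4 = 2 * 2); last by ring.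
      rewrite !exprMn ler_wpM2r ?exprn_ge0 ?(ltW q0) // ler_wpM2l ?exprn_ge0 //.
      by rewrite -[leLHS]expr1 ler_weXn2l // ler1n.
    apply: le_trans le4q (le_trans _ q4); apply: ler_iXnr => //.
      by rewrite mulr_ge0 // ltW.
    exact: le_trans q4 e1.
  apply: le_trans (_ : e * 'C(#|E|, m)%:R <= _); last by rewrite ler_wpM2r.
  apply: le_trans (_ : 2 ^+ #|V| * 2 * q ^+ #|V| * 'C(#|E|, m)%:R <= _); last first.
    by rewrite ler_wpM2r.
  rewrite -[leRHS]mulrA -[leRHS]mulrA [_ * 'C(_, _)%:R]mulrC.
  by rewrite ler_wpM2l ?exprn_ge0 // ler_wpM2l // ler_wpM2l.
Qed.
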